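(* Let $F$ be a field of characteristic two and let $(A,\sigma)$ be a central simple $F$-algebra with orthogonal involution. Let $S(A,\sigma)$ be its alternator subalgebra, $q_\sigma$ its alternator form, and $\mathrm{Sym}(A,\sigma)=\{x\in A\mid\sigma(x)=x\}$. If any of the following conditions is satisfied, then $\sigma$ is anisotropic: (i) $q_\sigma$ is anisotropic. (ii) $S(A,\sigma)$ is a field. (iii) $S(A,\sigma)\subseteq\mathrm{Sym}(A,\sigma)$.
   Context: $F$ is a field of characteristic two; central simple algebras are finite-dimensional. An involution $\sigma$ on a central simple $F$-algebra $A$ is an anti-automorphism of order two; it is of the first kind if it is the identity on $F$. Put $\mathrm{Alt}(A,\sigma)=\{x-\sigma(x)\mid x\in A\}$. An involution of the first kind is orthogonal if and only if $1\notin\mathrm{Alt}(A,\sigma)$. For $\sigma$ orthogonal, define the alternator subalgebra $S(A,\sigma)=\{x\in A\mid \sigma(x)x\in F\oplus\mathrm{Alt}(A,\sigma)\}$ (it is a unitary $F$-subalgebra of $A$) and, for $x\in S(A,\sigma)$, let $q_\sigma(x)$ be the unique element of $F$ with $\sigma(x)x+q_\sigma(x)\in\mathrm{Alt}(A,\sigma)$; the map $q_\sigma:S(A,\sigma)\to F$ is a totally singular quadratic form (i.e. a quadratic form whose polar form is zero), called the alternator form. A quadratic form $q$ is isotropic if $q(v)=0$ for some $v\neq0$, anisotropic otherwise. The involution $\sigma$ is isotropic if $\sigma(x)x=0$ for some nonzero $x\in A$, anisotropic otherwise. *)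

(* Defs.v *)
From HB Require Import structures.
From mathcomp Require Import all_boot all_order all_algebra all_field.
From mathcomp Require Import boolp classical_sets.

Set Implicit Arguments.
Unset Strict Implicit.
Unset Printing Implicit Defensive.

Import GRing.Theory.
Local Open Scope classical_set_scope.
Local Open Scope ring_scope.

Section CentralSimple.
Variables (F : fieldType) (A : falgType F).

(* A two-sided ideal of a unital F-algebra is an F-subspace, so quantifying
   over {vspace A} covers all of them; A != 0 is part of falgType. *)
Definition two_sided_ideal (I : {vspace A}) : Prop :=
  forall a x, x \in I -> a * x \in I /\ x * a \in I.

Definition central_simple : Prop :=
  'Z({:A})%VS = 1%VS /\
  (forall I : {vspace A}, two_sided_ideal I -> I = 0%VS \/ I = fullv).

Definition is_field (K : set A) : Prop :=
  [/\ K 1,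
      forall x y, K x -> K y -> K (x - y) /\ K (x * y),
      forall x y, K x -> K y -> x * y = y * x
    & forall x, K x -> x != 0 -> exists2 y, K y & x * y = 1].

End CentralSimple.

Section Involution.
Variables (F : fieldType) (A : falgType F).
Implicit Types (sigma : A -> A) (x y z : A).

(* "Order two" is read as sigma \o sigma = id; the identity, which satisfies
   these conditions only if A is commutative, is allowed. *)
Definition involution sigma : Prop :=
  [/\ forall x y, sigma (x + y) = sigma x + sigma y,
      forall x y, sigma (x * y) = sigma y * sigma x
    & forall x, sigma (sigma x) = x].

Definition first_kind sigma : Prop := forall a : F, sigma a%:A = a%:A.

Definition Alt sigma : set A := [set x - sigma x | x in [set: A]].

Definition Sym sigma : set A := [set x | sigma x = x].

Definition orthogonal_involution sigma : Prop :=
  [/\ involution sigma, first_kind sigma & ~ Alt sigma 1].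

(* The sum F + Alt(A, sigma) is direct as soon as 1 is not in Alt(A, sigma). *)
Definition alternator sigma : set A :=
  [set x | exists (a : F) (z : A), Alt sigma z /\ sigma x * x = a%:A + z].

(* The value is irrelevant (0) outside alternator sigma. *)
Definition alternator_form sigma (x : A) : F :=
  xget 0 [set a : F | Alt sigma (sigma x * x + a%:A)].

Definition form_isotropic (V : set A) (q : A -> F) : Prop :=
  exists x, [/\ V x, x != 0 & q x = 0].

Definition form_anisotropic (V : set A) (q : A -> F) : Prop :=
  ~ form_isotropic V q.

Definition isotropic sigma : Prop :=
  exists2 x : A, x != 0 & sigma x * x = 0.

Definition anisotropic sigma : Prop := ~ isotropic sigma.

Section Facts.
Variable sigma : A -> A.
Hypothesis sigma_orth : orthogonal_involution sigma.

Let sD x y : sigma (x + y) = sigma x + sigma y.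
Proof. by case: sigma_orth => [[]]. Qed.

Let sM x y : sigma (x * y) = sigma y * sigma x.
Proof. by case: sigma_orth => [[]]. Qed.

Let sA (a : F) : sigma a%:A = a%:A.
Proof. by case: sigma_orth. Qed.

Let sZ (a : F) x : sigma (a *: x) = a *: sigma x.
Proof. by rewrite -[a *: x]mulr_algl sM sA mulr_algr. Qed.

Let sN x : sigma (- x) = - sigma x.
Proof. by rewrite -scaleN1r sZ scaleN1r. Qed.

Lemma Alt_lin (a : F) x y : Alt sigma x -> Alt sigma y -> Alt sigma (a *: x + y).
Proof.
move=> [u _ <-] [v _ <-]; exists (a *: u + v) => //.
by rewrite sD sZ scalerBr opprD addrACA.
Qed.

Lemma alternator_form_unique x (a b : F) :
  Alt sigma (sigma x * x + a%:A) -> Alt sigma (sigma x * x + b%:A) -> a = b.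
Proof.
move=> Ha Hb; have := Alt_lin (-1) Hb Ha.
rewrite scaleN1r opprD addrACA addNr add0r addrC -scalerBl => Hab.
apply/eqP; rewrite -subr_eq0; apply/negP => /negP ne0.
case: sigma_orth => _ _; apply.
have A0 : Alt sigma 0 by exists 0 => //; rewrite -(scale0r 0) sZ !scale0r subr0.
by have := Alt_lin (a - b)^-1 Hab A0; rewrite addr0 scalerA mulVf // scale1r.
Qed.

Lemma alternator_formP x : alternator sigma x ->
  Alt sigma (sigma x * x + (alternator_form sigma x)%:A).
Proof.
move=> [a [z [Az xE]]]; rewrite /alternator_form.
apply: (@xgetPex _ 0 [set c : F | Alt sigma (sigma x * x + c%:A)]).
by exists (- a); rewrite /= xE scaleNr addrAC subrr add0r.
Qed.

Hypothesis F2 : 2%N \in [pchar F].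

Lemma alternator1 : alternator sigma 1.
Proof.
exists 1, 0; split; last by rewrite -[1 in LHS]scale1r sA scale1r mulr1 addr0.
by exists 0 => //; rewrite -(scale0r 0) sZ !scale0r subr0.
Qed.

Lemma alternator_sqr (a : F) x y : exists2 z, Alt sigma z &
  sigma (a *: x + y) * (a *: x + y) =
  a ^+ 2 *: (sigma x * x) + sigma y * y + z.
Proof.
have opp2 z : - z = z.
  apply/esym/eqP; rewrite -subr_eq0 opprK -mulr2n -scaler_nat.
  by rewrite (pcharf0 F2) scale0r.
have sK : sigma (sigma x) = x by case: sigma_orth => [[]].
exists (a *: (sigma x * y) - sigma (a *: (sigma x * y))).
  by exists (a *: (sigma x * y)).
rewrite opp2 sD sZ sZ sM sK mulrDl !mulrDr -!scalerAl -!scalerAr scalerA -expr2.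
by rewrite (AC (2*2) (1*4*(2*3))).
Qed.

Lemma alternator_lin (a : F) x y :
  alternator sigma x -> alternator sigma y -> alternator sigma (a *: x + y).
Proof.
move=> [b [u [Au xE]]] [c [v [Av yE]]].
have [z Az E] := alternator_sqr a x y.
exists (a ^+ 2 * b + c), (a ^+ 2 *: u + v + z); split.
  rewrite -[X in X + z]scale1r; apply: Alt_lin => //; exact: Alt_lin.
rewrite E xE yE scalerDr scalerA scalerDl addrACA !addrA //.
Qed.

Lemma alternator_form_lin (a : F) x y :
  alternator sigma x -> alternator sigma y ->
  alternator_form sigma (a *: x + y) =
  a ^+ 2 * alternator_form sigma x + alternator_form sigma y.
Proof.
move=> Sx Sy; apply: (@alternator_form_unique (a *: x + y)).
  exact/alternator_formP/alternator_lin.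
have [z Az ->] := alternator_sqr a x y.
rewrite addrAC scalerDl -scalerA addrACA -scalerDr -[X in X + z]scale1r.
apply: Alt_lin => //; apply: Alt_lin; exact: alternator_formP.
Qed.

Lemma alternatorM x y :
  alternator sigma x -> alternator sigma y -> alternator sigma (x * y).
Proof.
have sK z : sigma (sigma z) = z by case: sigma_orth => [[]].
move=> [b [u [[w _ <-] xE]]] [c [v [Av yE]]].
exists (b * c), (b *: v + (sigma y * w * y - sigma (sigma y * w * y))).
split; first by apply: Alt_lin => //; exists (sigma y * w * y).
rewrite !sM sK mulrA -(mulrA (sigma y)) xE mulrDr mulrDl mulr_algr.
rewrite -scalerAl yE scalerDr scalerA -addrA; congr (_ + (_ + _)).
by rewrite mulrBr mulrBl !mulrA.
Qed.

End Facts.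

End Involution.

(* Main.v *)
(* If sigma x * x = 0 with x != 0, then x * A lies in S(A, sigma) and q_sigma x = 0,
   which settles (i); in case (ii) x would be invertible.  In case (iii) all the
   x * a are symmetric, so x * a = sigma a * x and A * x is a nonzero two-sided
   ideal; by simplicity x is then invertible, whereas x * x = sigma x * x = 0. *)

Require Import Defs.
From mathcomp Require Import all_boot all_order all_algebra all_field.
From mathcomp Require Import boolp classical_sets.

Import GRing.Theory.
Local Open Scope classical_set_scope.
Local Open Scope ring_scope.

Section IsotropicElements.
Context {F : fieldType} {A : falgType F} {sigma : A -> A}.

Lemma involution0 : involution sigma -> sigma 0 = 0.
Proof. by case=> sD _ _; apply: (addrI (sigma 0)); rewrite -sD !addr0. Qed.

Lemma Alt0 : involution sigma -> Alt sigma 0.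
Proof. by move=> inv; exists 0; rewrite // involution0 // subr0. Qed.

Lemma isotropic_alternator x :
  involution sigma -> sigma x * x = 0 -> alternator sigma x.
Proof.
by move=> inv x0; exists 0, 0; split; [exact: Alt0 | rewrite x0 scale0r addr0].
Qed.

(** Since [sigma x * x + 0] is zero, hence alternating, 0 qualifies as a value of the form at [x];
    uniqueness of that value concludes. *)
Lemma isotropic_alternator_form x :
  orthogonal_involution sigma -> sigma x * x = 0 -> alternator_form sigma x = 0.
Proof.
move=> orth x0; have [inv _ _] := orth.
apply: (alternator_form_unique orth (x := x)).
  exact/alternator_formP/isotropic_alternator.
by rewrite x0 scale0r addr0; exact: Alt0.
Qed.

Lemma isotropic_mulr x a :
  involution sigma -> sigma x * x = 0 -> sigma (x * a) * (x * a) = 0.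
Proof.
by case=> _ sM _ x0; rewrite sM -mulrA (mulrA (sigma x)) x0 mul0r mulr0.
Qed.

(** The left ideal [A * x], encoded as the image of [amulr x], is also a right ideal because
    [(a * x) * b = (a * f b) * x]. It contains [x], which is nonzero, so by simplicity it contains
    1. *)
Lemma simple_linv (f : A -> A) x : central_simple A ->
  x != 0 -> (forall a, x * a = f a * x) -> exists a, a * x = 1.
Proof.
move=> [_ simple] x0 xf; have memI a : a * x \in limg (amulr x).
  by have := memv_img (amulr x) (memvf a); rewrite lfunE.
have [b y /memv_imgP[a _ ->]|I0|I1] := simple (limg (amulr x)).
- by rewrite lfunE /=; split; last rewrite -mulrA xf; rewrite mulrA.
- by have := memI 1; rewrite I0 memv0 mul1r (negPf x0).
- have : 1 \in limg (amulr x) by rewrite I1 memvf.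
  by case/memv_imgP => a _; rewrite lfunE /= => ->; exists a.
Qed.

End IsotropicElements.

Theorem corollary3p10 (F : fieldType) (F_char2 : 2%N \in [pchar F])
    (A : falgType F) (A_cs : central_simple A)
    (sigma : A -> A) (sigma_orth : orthogonal_involution sigma) :
  [\/ form_anisotropic (alternator sigma) (alternator_form sigma),
      is_field (alternator sigma)
    | alternator sigma `<=` Sym sigma] ->
  anisotropic sigma.
Proof.
move=> hyp [x x0 sxx]; have [inv _ _] := sigma_orth; have [_ sM sK] := inv.
have Sx := isotropic_alternator x inv sxx.
case: hyp => [qan|[_ _ _ Sinv]|Ssym].
- by apply: qan; exists x; split=> //; exact: isotropic_alternator_form.
- have [y _ xy1] := Sinv x Sx x0.
  have sx0 : sigma x = 0 by rewrite -[LHS]mulr1 -xy1 mulrA sxx mul0r.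
  by move: x0; rewrite -(sK x) sx0 involution0 // eqxx.
- have xsym : sigma x = x := Ssym x Sx.
  (* Here [f] is [sigma]: symmetry of [x * a] and of [x] gives
     [x * a = sigma (x * a) = sigma a * x]. *)
  have [a|a ax1] := simple_linv sigma x A_cs x0.
    have /Ssym <- : alternator sigma (x * a).
      exact/isotropic_alternator/isotropic_mulr.
    by rewrite sM xsym.
  (* The left inverse [a] yields [x = a * (x * x) = a * (sigma x * x) = 0]. *)
  by move: x0; rewrite -(mul1r x) -ax1 -mulrA -{1}xsym sxx mulr0 eqxx.
Qed.
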